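(* Let $\hat u_{x,y}=u_{x,y}+v_{x,y}$ with $$v_{x,y}=\sum_{a=1}^q\sum_{m=0}^{\kappa^{(a)}-1}\frac{(-1)^m}{m!}\big(\beta^{(a)}_m\big)_x\otimes\delta^{(m)}(y-x_a),\qquad \big(\beta^{(a)}_m\big)_x\in\big(\mathbb C^{p\times p}[x]\big)',$$ where $x_1,\dots,x_q$ are distinct, the family $\{\beta^{(a)}_m\}$ is linearly independent in the bimodule $\big(\mathbb C^{p\times p}[x]\big)'$, $u$ and $\hat u$ are quasidefinite, and put $N=\kappa^{(1)}+\dots+\kappa^{(q)}$. Whenever one of the two conditions $\big(\operatorname{Ker}^R_\beta\big)^{\perp^R_u}=\{0_p\}$ or $\mathbb I^{\perp^L_u}=\{0_p\}$ holds, the matrices $I_{Np}+\langle\mathcal J^{[0,1]}_{K_n}(x),(\beta)_x\rangle$ are nonsingular, and the perturbed biorthogonal polynomials and matrices $\hat H_n$ are $$\hat P^{[1]}_n(x)=\Theta_*\begin{bmatrix}I_{Np}+\langle\mathcal J^{[0,1]}_{K_{n-1}}(x),(\beta)_x\rangle&\mathcal J^{[0,1]}_{K_{n-1}}(x)\\ \langle P^{[1]}_n(x),(\beta)_x\rangle&P^{[1]}_n(x)\end{bmatrix},$$ $$\big(\hat P^{[2]}_n(y)\big)^\top=\Theta_*\begin{bmatrix}I_{Np}+\langle\mathcal J^{[0,1]}_{K_{n-1}}(x),(\beta)_x\rangle&\big(\mathcal J_{P^{[2]}_n}\big)^\top\\ \langle K_{n-1}(x,y),(\beta)_x\rangle&\big(P^{[2]}_n(y)\big)^\top\end{bmatrix},$$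 $$\hat H_n=\Theta_*\begin{bmatrix}I_{Np}+\langle\mathcal J^{[0,1]}_{K_{n-1}}(x),(\beta)_x\rangle&-\big(\mathcal J_{P^{[2]}_n}\big)^\top\\ \langle P^{[1]}_n(x),(\beta)_x\rangle&H_n\end{bmatrix}.$$
   Context: Notation. $p\ge1$ is fixed; $I_p,0_p$ are the $p\times p$ identity and zero matrices. Semi-infinite matrices are written in $p\times p$ blocks indexed by $0,1,2,\dots$; $A_{[n]}$ is the truncation to the first $n$ block rows and columns. $\chi(x)=[I_p,I_px,I_px^2,\dots]^\top$. The last quasideterminant of a block matrix with $A$ square nonsingular is $\Theta_*\begin{bmatrix}A&B\\ C&D\end{bmatrix}=D-CA^{-1}B$, with $D$ the last $p\times p$ block. Generalized kernels. A $p\times p$ matrix $u=u_{x,y}$ of generalized functions of $(x,y)$, acting on polynomials, defines the sesquilinear form $\big(\langle P(x),Q(y)\rangle_u\big)_{i,j}=\sum_{k,l}\langle (u_{x,y})_{k,l},P_{i,k}(x)Q_{j,l}(y)\rangle$ on $\mathbb C^{p\times p}[x]$. Gram matrix: $G_{k,l}=\langle I_px^k,I_py^l\rangle_u$. $u$ is quasidefinite if $\det G_{[k]}\ne0$ for all $k\ge1$; then $G=S_1^{-1}HS_2^{-\top}$ uniquely, with $S_1,S_2$ lower unitriangular by blocks and $H=\operatorname{diag}(H_0,H_1,\dots)$. $P^{[i]}(x)=S_i\chi(x)$ has blocks $P^{[i]}_n$ (monic, degree $n$, $\langle P^{[1]}_n,P^{[2]}_m\rangle_u=\delta_{n,m}H_n$).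 The hatted objects are those of $\hat u$. $K_n(x,y)=\sum_{k=0}^n(P^{[2]}_k(y))^\top H_k^{-1}P^{[1]}_k(x)$ (and $K_{-1}=0$). For a matrix $\beta=(\beta_{k,j})\in(\mathbb C^{p\times p}[x])'$ of linear functionals, $\langle P(x),(\beta)_x\rangle$ is the matrix with entries $\sum_k\langle\beta_{k,j},P_{i,k}(x)\rangle$ (for $P$ with any number of rows and $p$ columns). Linear independence means: $\sum_{a,m}\beta^{(a)}_mX^{(a)}_m=0$ with $X^{(a)}_m\in\mathbb C^{p\times p}$ only if all $X^{(a)}_m=0_p$, and $\sum_{a,m}Y^{(a)}_m\beta^{(a)}_m=0$ with $Y^{(a)}_m\in\mathbb C^{p\times p}$ only if all $Y^{(a)}_m=0_p$. The form of $v$ is $\langle P,Q\rangle_v=\sum_{a,m}\frac1{m!}\langle P(x),(\beta^{(a)}_m)_x\rangle\big((Q(y))^\top\big)^{(m)}_{x_a}$, with $(f)^{(m)}_{x_a}$ the $m$-th derivative at $x_a$. $\langle P(x),(\beta)_x\rangle:=\big[\langle P,(\beta^{(1)}_0)_x\rangle,\dots,\langle P,(\beta^{(1)}_{\kappa^{(1)}-1})_x\rangle,\dots,\langle P,(\beta^{(q)}_0)_x\rangle,\dots,\langle P,(\beta^{(q)}_{\kappa^{(q)}-1})_x\rangle\big]$. Spectral jets: $\mathcal J_f=\Big[f(x_1),\dots,\frac{(f)^{(\kappa^{(1)}-1)}_{x_1}}{(\kappa^{(1)}-1)!},\dots,f(x_q),\dots,\frac{(f)^{(\kappa^{(q)}-1)}_{x_q}}{(\kappa^{(q)}-1)!}\Big]\in\mathbb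 C^{p\times Np}$; for a kernel $K(x,y)$, $\mathcal J^{[0,1]}_K(x)\in\mathbb C^{Np\times p}$ is the block column formed, in the same order, by $\frac1{m!}\frac{\partial^mK}{\partial y^m}(x,x_a)$, $0\le m\le\kappa^{(a)}-1$, $a=1,\dots,q$. $\operatorname{Ker}^R_\beta:=\{P\in\mathbb C^{p\times p}[x]:\langle P(x),(\beta^{(a)}_m)_x\rangle=0_p,\ a\in\{1,\dots,q\},\ m\in\{0,\dots,\kappa^{(a)}-1\}\}$; $\mathbb I:=(x-x_1)^{\kappa^{(1)}}\cdots(x-x_q)^{\kappa^{(q)}}\mathbb C^{p\times p}[x]$; $\big(\operatorname{Ker}^R_\beta\big)^{\perp^R_u}:=\{Q:\langle P(x),Q(y)\rangle_u=0_p\ \forall P\in\operatorname{Ker}^R_\beta\}$; $\mathbb I^{\perp^L_u}:=\{Q:\langle Q(x),P(y)\rangle_u=0_p\ \forall P\in\mathbb I\}$. *)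

(* Defs.v *)
From HB Require Import structures.
From mathcomp Require Import all_boot all_order all_algebra.
From mathcomp Require Import all_classical all_reals.
From mathcomp Require Import complex.

Set Implicit Arguments.
Unset Strict Implicit.
Unset Printing Implicit Defensive.

Import GRing.Theory.
Local Open Scope classical_set_scope.
Local Open Scope ring_scope.

(* Conventions.
   - The p x p matrix polynomials F^{p x p}[x] are 'M[{poly F}]_p.
   - F[x,y] is {poly {poly F}}: the outer indeterminate is y and the inner one
     is x, so that P(x) is P%:P, Q(y) is Q^:P, and evaluating f(x,y) at y = a
     is f.[a%:P].
   - Semi-infinite block matrices are functions nat -> nat -> 'M[F]_p. *)

Definition theta (R : comUnitRingType) (n r : nat) (M : 'M[R]_(n + r)) : 'M[R]_r :=
  drsubmx M - dlsubmx M *m invmx (ulsubmx M) *m ursubmx M.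

(* A generalized function of (x,y), acting on polynomials, is a map
   F[x,y] -> F that is linear over F. {poly {poly F}} carries no library
   F-module structure, so linearity is stated explicitly. *)
Definition linear_kernel (F : fieldType) (p : nat)
    (u : 'M[{poly {poly F}} -> F]_p) : Prop :=
  forall (k l : 'I_p) (c : F) (f g : {poly {poly F}}),
    u k l (c%:P *: f + g) = c * u k l f + u k l g.

Definition uform (F : fieldType) (p : nat) (u : 'M[{poly {poly F}} -> F]_p)
    (P Q : 'M[{poly F}]_p) : 'M[F]_p :=
  \matrix_(i, j) \sum_k \sum_l u k l ((P i k)%:P * (Q j l)^:P).

Definition gram (F : fieldType) (p : nat) (u : 'M[{poly {poly F}} -> F]_p)
    (k l : nat) : 'M[F]_p :=
  uform u ('X^k)%:M ('X^l)%:M.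

Definition trunc (F : fieldType) (p n : nat) (A : nat -> nat -> 'M[F]_p) :
    'M[F]_(\sum_(k < n) p) :=
  \mxblock_(k < n, l < n) A k l.

Definition quasidefinite (F : fieldType) (p : nat)
    (u : 'M[{poly {poly F}} -> F]_p) : Prop :=
  forall k : nat, (1 <= k)%N -> \det (trunc k (gram u)) != 0.

Definition lower_unitriangular (F : fieldType) (p : nat)
    (S : nat -> nat -> 'M[F]_p) : Prop :=
  (forall k, S k k = 1%:M) /\ (forall k l, (k < l)%N -> S k l = 0).

Definition bdiag (F : fieldType) (p : nat) (H : nat -> 'M[F]_p)
    (k l : nat) : 'M[F]_p :=
  if k == l then H k else 0.

(* G = S1^{-1} H S2^{-T}. Truncation commutes with inversion of unitriangular
   matrices and with the product lower * diagonal * upper, so the identity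
   between semi-infinite matrices is the one between all their truncations. *)
Definition gauss_borel (F : fieldType) (p : nat) (G : nat -> nat -> 'M[F]_p)
    (S1 : nat -> nat -> 'M[F]_p) (H : nat -> 'M[F]_p)
    (S2 : nat -> nat -> 'M[F]_p) : Prop :=
  [/\ lower_unitriangular S1, lower_unitriangular S2 &
      forall n, trunc n G =
        invmx (trunc n S1) *m trunc n (bdiag H) *m (invmx (trunc n S2))^T].

(* Row n of S chi(x), for S lower triangular. *)
Definition bpoly (F : fieldType) (p : nat) (S : nat -> nat -> 'M[F]_p)
    (n : nat) : 'M[{poly F}]_p :=
  \sum_(l < n.+1) 'X^l *: map_mx polyC (S n l).

(* K_{n-1}(x,y), the sum having n terms; in particular K_{-1} = 0 is CD 0. *)
Definition CD (F : fieldType) (p : nat) (S1 : nat -> nat -> 'M[F]_p)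
    (H : nat -> 'M[F]_p) (S2 : nat -> nat -> 'M[F]_p) (n : nat) :
    'M[{poly {poly F}}]_p :=
  \sum_(k < n) (map_mx (map_poly polyC) (bpoly S2 k))^T
     *m map_mx (fun c : F => c%:P%:P) (invmx (H k))
     *m map_mx polyC (bpoly S1 k).

(* N p, where N = kappa^(1) + ... + kappa^(q), presented as the dimension of
   block rows and columns indexed by the pairs (a, m) in lexicographic order. *)
Definition jdim (p q : nat) (kappa : 'I_q -> nat) : nat :=
  \sum_(a < q) \sum_(m < kappa a) p.

Definition fpair (F : fieldType) (p r : nat) (P : 'M[{poly F}]_(r, p))
    (b : 'M[{scalar {poly F}}]_p) : 'M[F]_(r, p) :=
  \matrix_(i, j) \sum_k b k j (P i k).

Definition fpair_row (F : fieldType) (p q : nat) (kappa : 'I_q -> nat) (r : nat)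
    (P : 'M[{poly F}]_(r, p))
    (beta : forall a : 'I_q, 'I_(kappa a) -> 'M[{scalar {poly F}}]_p) :
    'M[F]_(r, jdim p kappa) :=
  \mxrow_(a < q) \mxrow_(m < kappa a) fpair P (beta a m).

(* The functionals act on x; what is left is a polynomial in y. *)
Definition kpair (F : fieldType) (p r : nat) (K : 'M[{poly {poly F}}]_(r, p))
    (b : 'M[{scalar {poly F}}]_p) : 'M[{poly F}]_(r, p) :=
  \matrix_(i, j) \sum_k map_poly (b k j) (K i k).

Definition kpair_row (F : fieldType) (p q : nat) (kappa : 'I_q -> nat) (r : nat)
    (K : 'M[{poly {poly F}}]_(r, p))
    (beta : forall a : 'I_q, 'I_(kappa a) -> 'M[{scalar {poly F}}]_p) :
    'M[{poly F}]_(r, jdim p kappa) :=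
  \mxrow_(a < q) \mxrow_(m < kappa a) kpair K (beta a m).

Definition jet (F : fieldType) (p q : nat) (x : 'I_q -> F) (kappa : 'I_q -> nat)
    (f : 'M[{poly F}]_p) : 'M[F]_(p, jdim p kappa) :=
  \mxrow_(a < q) \mxrow_(m < kappa a)
    map_mx (fun h : {poly F} => (m`!%:R)^-1 * (h^`(m)).[x a]) f.

Definition jet01 (F : fieldType) (p q : nat) (x : 'I_q -> F)
    (kappa : 'I_q -> nat) (K : 'M[{poly {poly F}}]_p) :
    'M[{poly F}]_(jdim p kappa, p) :=
  \mxcol_(a < q) \mxcol_(m < kappa a)
    map_mx (fun h : {poly {poly F}} => (m`!%:R : F)^-1 *: (h^`(m)).[(x a)%:P]) K.

(* b_x (x) d_y, for linear functionals b and d on F[x] and F[y]. *)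
Definition tensor (F : fieldType) (b d : {poly F} -> F) (f : {poly {poly F}}) : F :=
  d (map_poly b f).

(* delta^(m)(y - a) *)
Definition ddelta (F : fieldType) (m : nat) (a : F) (f : {poly F}) : F :=
  (-1) ^+ m * (f^`(m)).[a].

Definition vkernel (F : fieldType) (p q : nat) (x : 'I_q -> F)
    (kappa : 'I_q -> nat)
    (beta : forall a : 'I_q, 'I_(kappa a) -> 'M[{scalar {poly F}}]_p) :
    'M[{poly {poly F}} -> F]_p :=
  \matrix_(k, l) fun f => \sum_(a < q) \sum_(m < kappa a)
    (-1) ^+ m / m`!%:R * tensor (beta a m k l) (ddelta m (x a)) f.

Definition kadd (F : fieldType) (p : nat) (u v : 'M[{poly {poly F}} -> F]_p) :
    'M[{poly {poly F}} -> F]_p :=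
  \matrix_(k, l) fun f => u k l f + v k l f.

(* The value at f of the matrix of functionals beta X is beta(f) X, where
   beta(f) = [beta_{k,j}(f)]; likewise on the left. *)
Definition feval (F : fieldType) (p : nat) (b : 'M[{scalar {poly F}}]_p)
    (f : {poly F}) : 'M[F]_p :=
  \matrix_(k, j) b k j f.

Definition bimod_independent (F : fieldType) (p q : nat) (kappa : 'I_q -> nat)
    (beta : forall a : 'I_q, 'I_(kappa a) -> 'M[{scalar {poly F}}]_p) : Prop :=
  (forall X : (forall a : 'I_q, 'I_(kappa a) -> 'M[F]_p),
     (forall f : {poly F},
        \sum_(a < q) \sum_(m < kappa a) feval (beta a m) f *m X a m = 0) ->
     forall a m, X a m = 0) /\
  (forall Y : (forall a : 'I_q, 'I_(kappa a) -> 'M[F]_p),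
     (forall f : {poly F},
        \sum_(a < q) \sum_(m < kappa a) Y a m *m feval (beta a m) f = 0) ->
     forall a m, Y a m = 0).

Definition KerR (F : fieldType) (p q : nat) (kappa : 'I_q -> nat)
    (beta : forall a : 'I_q, 'I_(kappa a) -> 'M[{scalar {poly F}}]_p) :
    set 'M[{poly F}]_p :=
  [set P | forall a m, fpair P (beta a m) = 0].

Definition ideal (F : fieldType) (p q : nat) (x : 'I_q -> F)
    (kappa : 'I_q -> nat) : set 'M[{poly F}]_p :=
  [set P | exists R : 'M[{poly F}]_p,
     P = (\prod_(a < q) ('X - (x a)%:P) ^+ kappa a) *: R].

Definition perpR (F : fieldType) (p : nat) (u : 'M[{poly {poly F}} -> F]_p)
    (A : set 'M[{poly F}]_p) : set 'M[{poly F}]_p :=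
  [set Q | forall P, A P -> uform u P Q = 0].

Definition perpL (F : fieldType) (p : nat) (u : 'M[{poly {poly F}} -> F]_p)
    (A : set 'M[{poly F}]_p) : set 'M[{poly F}]_p :=
  [set Q | forall P, A P -> uform u Q P = 0].

(* I_{Np} + <J^{[0,1]}_K(x), (beta)_x> *)
Definition pert_mx (F : fieldType) (p q : nat) (x : 'I_q -> F)
    (kappa : 'I_q -> nat)
    (beta : forall a : 'I_q, 'I_(kappa a) -> 'M[{scalar {poly F}}]_p)
    (K : 'M[{poly {poly F}}]_p) : 'M[F]_(jdim p kappa) :=
  1%:M + fpair_row (jet01 x kappa K) beta.

(* Main.v *)
Require Import Defs.
From HB Require Import structures.
From mathcomp Require Import all_boot all_order all_algebra.
From mathcomp Require Import all_classical all_reals.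
From mathcomp Require Import complex.

Set Implicit Arguments.
Unset Strict Implicit.
Unset Printing Implicit Defensive.

Import GRing.Theory.
Local Open Scope classical_set_scope.
Local Open Scope ring_scope.

(** Truncate every semi-infinite matrix to n block rows and columns. Write G for
    the truncated Gram matrix of u, chi for the block column of the monomials
    1, x, ..., x^(n-1), B for the block column of the pairings of x^k with beta
    (k < n), J for the block row of the transposed jets of y^l (l < n), and hats
    for the objects of the perturbed kernel. The perturbation has finite rank:
    its moments factor as (pairing of x^k) * (jet of y^l)^T, so (gram_vkernel)

      Gh = G + B J,   gh = g + b J,   ch = c + B j,   gh_nn = g_nn + b j,

    where g, c, g_nn are the last row, last column and corner of the next
    truncation, b is the pairing of x^n and j the transposed jet of y^n.

    Everything in the theorem is a Schur complement with respect to G or Gh. By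
    orthogonality to the lower monomials (gauss_borel_row),

      P1_n = Theta [G, chi; g, x^n],   P2_n^T = Theta [G, c; chi^T, y^n],
      H_n = Theta [G, c; g, g_nn],

    and the Christoffel-Darboux kernel is chi(y)^T G^-1 chi(x) (CD_E). The
    matrix to be inverted in the theorem is therefore I + J G^-1 B, and likewise
    its borders become the pairing b - g G^-1 B of P1_n, the jet j - J G^-1 c of
    P2_n, the jet J G^-1 chi of the kernel in y and its pairing chi^T G^-1 B in x.

    The theorem is now one identity, theta_pert: in the bordered matrix

      [ G   B   c ]
      [ -J  I  -j ]
      [ g   b   d ]

    one may eliminate the middle block first, which leaves the quasideterminant
    of the perturbed data (G + B J and its borders), or G first, which leaves
    the quasideterminant built on I + J G^-1 B. Both eliminations end with the
    same block. The invertibility of I + J G^-1 B is the same fact one step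
    earlier: det G * det (I + J G^-1 B) = det Gh, and both G and Gh are
    invertible by quasidefiniteness. *)

(** * Quasideterminants under finite-rank perturbation *)

Lemma theta_block (R : comUnitRingType) (n r : nat) (A : 'M[R]_n)
    (B : 'M_(n, r)) (C : 'M_(r, n)) (D : 'M_r) :
  theta (block_mx A B C D) = D - C *m invmx A *m B.
Proof. by rewrite /theta block_mxKdr block_mxKdl block_mxKul block_mxKur. Qed.

Lemma tr_theta (R : comUnitRingType) (n r : nat) (A : 'M[R]_n)
    (B : 'M_(n, r)) (C : 'M_(r, n)) (D : 'M_r) :
  (theta (block_mx A B C D))^T = theta (block_mx A^T C^T B^T D^T).
Proof. by rewrite !theta_block linearB /= !trmx_mul trmx_inv mulmxA. Qed.

(** Lets a quasideterminant be computed from any solution of A X = B, so that the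
    inverse of a perturbed matrix never has to be written down. *)
Lemma theta_solve (R : comUnitRingType) (n r : nat) (A : 'M[R]_n)
    (X B : 'M_(n, r)) (C : 'M_(r, n)) (D : 'M_r) :
  A \in unitmx -> A *m X = B -> theta (block_mx A B C D) = D - C *m X.
Proof.
move=> uA <-.
by rewrite /theta block_mxKdr block_mxKdl block_mxKul block_mxKur -mulmxA mulKmx.
Qed.

Lemma thetaNN (R : comUnitRingType) (n r : nat) (A : 'M[R]_n)
    (B : 'M_(n, r)) (C : 'M_(r, n)) (D : 'M_r) :
  theta (block_mx A (- B) (- C) D) = theta (block_mx A B C D).
Proof.
rewrite /theta !block_mxKdr !block_mxKdl !block_mxKul !block_mxKur.
by rewrite !mulNmx mulmxN opprK.
Qed.

Section Perturbation.
Variables (R : comUnitRingType) (s t : nat).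
Variables (G : 'M[R]_s) (B : 'M[R]_(s, t)) (J : 'M[R]_(t, s)).
Hypotheses (uG : G \in unitmx) (uGh : G + B *m J \in unitmx).

Let M := 1%:M + J *m invmx G *m B.
Let Gh := G + B *m J.

(** The Sherman-Morrison-Woodbury formula read backwards: the inverse of M is
    I - J Gh^-1 B, because M J = J G^-1 Gh. *)
Lemma pert_unitmx : M \in unitmx.
Proof.
have MJ : M *m J = J *m invmx G *m Gh.
  by rewrite mulmxDl mul1mx mulmxDr mulmxKV // mulmxA.
suff /mulmx1_unit[] : M *m (1%:M - J *m invmx Gh *m B) = 1%:M by [].
by rewrite mulmxBr mulmx1 !mulmxA MJ mulmxK // addrK.
Qed.

(** The two orders of elimination in the bordered matrix described above: the
    left side eliminates the identity block first, the right side eliminates G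
    first. *)
Lemma theta_pert (r : nat) (c : 'M_(s, r)) (j : 'M_(t, r))
    (g : 'M_(r, s)) (b : 'M_(r, t)) (d : 'M_r) :
  theta (block_mx Gh (c + B *m j) (g + b *m J) (d + b *m j)) =
  theta (block_mx M (J *m invmx G *m c - j) (b - g *m invmx G *m B)
                  (theta (block_mx G c g d))).
Proof.
rewrite theta_block; set w := J *m invmx G *m c - j.
have [y My] : exists y, M *m y = w.
  by exists (invmx M *m w); rewrite mulKVmx ?pert_unitmx.
have JX : J *m (invmx G *m (c - B *m y)) = y + j.
  rewrite !mulmxBr !mulmxA; apply/eqP; rewrite subr_eq -(subrK j (J *m _ *m c)).
  by rewrite -/w -My mulmxDl mul1mx addrAC.
(* With M y = w, the column solved for on the left is G^-1 (c - B y): this is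
   back substitution in the bordered system. *)
rewrite (@theta_solve _ _ _ Gh (invmx G *m (c - B *m y))) //; last first.
  by rewrite mulmxDl mulKVmx // -mulmxA JX mulmxDr addrA subrK.
rewrite (@theta_solve _ _ _ M y) ?pert_unitmx //.
rewrite mulmxDl -mulmxA JX mulmxDr mulmxBl !mulmxBr !mulmxA.
rewrite (addrA (_ - _)) opprD addrACA subrr addr0 -[RHS]addrA -opprD.
by rewrite -[_ - _ + _]addrA [- _ + b *m y]addrC.
Qed.
End Perturbation.

(** * Consequences of the Gauss-Borel factorization *)

Section GaussBorel.
Variables (F : fieldType) (p : nat).
Implicit Types (S G : nat -> nat -> 'M[F]_p) (H : nat -> 'M[F]_p).

Lemma mul_trunc n (A B : nat -> nat -> 'M[F]_p) :
  trunc n A *m trunc n B = \mxblock_(i < n, j < n) \sum_(k < n) A i k *m B k j.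
Proof. exact: mul_mxblock. Qed.

Lemma tr_trunc n (A : nat -> nat -> 'M[F]_p) :
  (trunc n A)^T = trunc n (fun k l => (A l k)^T).
Proof. exact: tr_mxblock. Qed.

Lemma mul_bdiag n H H' :
  trunc n (bdiag H) *m trunc n (bdiag H') = trunc n (bdiag (fun k => H k *m H' k)).
Proof.
rewrite mul_trunc; apply: eq_mxblock => i j; rewrite /bdiag.
rewrite (bigD1 i) //= eqxx big1 ?addr0 => [|k].
  by case: eqVneq => // _; rewrite mulmx0.
by rewrite -val_eqE eq_sym => /negPf ->; rewrite mul0mx.
Qed.

Lemma bdiag1 n : trunc n (bdiag (fun _ : nat => 1%:M : 'M[F]_p)) = 1%:M.
Proof.
rewrite -mxdiagZ /mxdiag; apply: eq_mxblock => i j.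
by rewrite conform_mx_id /bdiag.
Qed.

(** Transposing the Gram matrix exchanges the two families of polynomials, so
    that statements about the second one follow from those about the first. *)
Lemma gauss_borel_tr G S1 H S2 :
  gauss_borel G S1 H S2 ->
  gauss_borel (fun k l => (G l k)^T) S2 (fun k => (H k)^T) S1.
Proof.
case=> uS1 uS2 GE; split=> // n; rewrite -tr_trunc GE !trmx_mul trmxK mulmxA.
rewrite tr_trunc; congr (_ *m _ *m _); apply: eq_mxblock => i j.
by rewrite /bdiag eq_sym; case: eqVneq => [->|]; rewrite ?trmx0.
Qed.

Section Factored.
Variables (G S1 S2 : nat -> nat -> 'M[F]_p) (H : nat -> 'M[F]_p).
Hypothesis GE : gauss_borel G S1 H S2.
Hypothesis uG : forall n, trunc n G \in unitmx.

(** The factors inherit invertibility from G: invmx sends a singular matrix to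
    itself, so a singular S1 or S2 would make the product singular. *)
Lemma gauss_borel_unitmx n :
  [/\ trunc n S1 \in unitmx, trunc n (bdiag H) \in unitmx & trunc n S2 \in unitmx].
Proof.
case: GE => _ _ /(_ n) En; move: (uG n).
by rewrite En !unitmx_mul unitmx_tr !unitmx_inv => /andP[/andP[-> ->] ->].
Qed.

Lemma gauss_borel_trunc n :
  trunc n S1 *m trunc n G *m (trunc n S2)^T = trunc n (bdiag H).
Proof.
have [u1 _ u2] := gauss_borel_unitmx n; case: GE => _ _ ->.
rewrite -[_ *m (invmx _)^T]mulmxA mulKVmx // -mulmxA trmx_inv.
by rewrite mulVmx ?unitmx_tr // mulmx1.
Qed.

Lemma gauss_borel_unitH k : H k \in unitmx.
Proof.
have [_ uH _] := gauss_borel_unitmx k.+1.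
pose X := invmx (trunc k.+1 (bdiag H)).
have /mxblockP/(_ ord_max ord_max) := mulmxV uH.
rewrite -/X -[X]submxblockK mul_mxblock mxblockK -mxdiagZ submxblock_diag.
rewrite (bigD1 ord_max) //= big1 ?addr0 => [|j].
  by rewrite /bdiag eqxx => /mulmx1_unit[].
by rewrite -val_eqE eq_sym /bdiag => /negPf ->; rewrite mul0mx.
Qed.

Lemma gauss_borel_invmx n :
  invmx (trunc n G) =
    (trunc n S2)^T *m trunc n (bdiag (fun k => invmx (H k))) *m trunc n S1.
Proof.
have [u1 _ u2] := gauss_borel_unitmx n.
apply: (can_inj (mulKmx (uG n))); rewrite mulmxV //.
(* Conjugated by S1, the equation G X = 1 becomes H H^-1 = 1, because
   S1 G S2^T = H. *)
apply: (can_inj (mulKmx u1)); apply: (can_inj (mulmxK (etrans (unitmx_inv _) u1))).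
rewrite mulmx1 mulmxV // !mulmxA gauss_borel_trunc mul_bdiag.
rewrite -[LHS](bdiag1 n) mulmxK //.
by apply: eq_mxblock => k l; rewrite /bdiag mulmxV ?gauss_borel_unitH.
Qed.

(** Biorthogonality says that the pairings of P1_n with the second family vanish
    below n and give H n at n; as that family is monic and triangular, monomials
    can replace it one degree at a time. *)
Lemma gauss_borel_row n l : (l <= n)%N ->
  \sum_(k < n.+1) S1 n k *m G k l = if l == n then H n else 0.
Proof.
have [_ [S2d S2u] _] := GE.
elim/ltn_ind: l => l IHl le_ln; have lt_ln : (l < n.+1)%N by [].
have := gauss_borel_trunc n.+1.
rewrite tr_trunc mul_trunc [LHS]mul_mxblock [RHS]/trunc.
move/eq_mxblockP => /(_ ord_max (Ordinal lt_ln)) /=.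
rewrite (bigD1 (Ordinal lt_ln)) //= S2d trmx1 mulmx1 [X in _ + X]big1 ?addr0 => [->|k].
  by rewrite /bdiag eq_sym.
rewrite -val_eqE /= neq_ltn => /orP[lt_kl | lt_lk].
  by rewrite IHl ?(leq_trans (ltnW lt_kl)) // ltn_eqF ?mul0mx // (leq_trans lt_kl).
by rewrite S2u // trmx0 mulmx0.
Qed.

End Factored.
End GaussBorel.

(** * Biorthogonal polynomials as quasideterminants *)

Section Polynomials.
Variables (F : fieldType) (p : nat).
Implicit Types (S G : nat -> nat -> 'M[F]_p) (H : nat -> 'M[F]_p).

Definition monomials n : 'M[{poly F}]_(\sum_(k < n) p, p) := \mxcol_(k < n) ('X^k)%:M.

Definition last_row n G : 'M[F]_(p, \sum_(k < n) p) := \mxrow_(l < n) G n l.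
Definition last_col n G : 'M[F]_(\sum_(k < n) p, p) := \mxcol_(k < n) G k n.

Lemma map_mxrow (A B : Type) (f : A -> B) m n (q_ : 'I_n -> nat)
    (R_ : forall j, 'M[A]_(m, q_ j)) :
  map_mx f (\mxrow_j R_ j) = \mxrow_j map_mx f (R_ j).
Proof. by apply/matrixP => i j; rewrite !mxE. Qed.

Lemma map_mxcol (A B : Type) (f : A -> B) m n (p_ : 'I_n -> nat)
    (C_ : forall i, 'M[A]_(p_ i, m)) :
  map_mx f (\mxcol_i C_ i) = \mxcol_i map_mx f (C_ i).
Proof. by apply/matrixP => i j; rewrite !mxE. Qed.

Lemma map_mxblock (A B : Type) (f : A -> B) m n (p_ : 'I_m -> nat) (q_ : 'I_n -> nat)
    (B_ : forall i j, 'M[A]_(p_ i, q_ j)) :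
  map_mx f (\mxblock_(i, j) B_ i j) = \mxblock_(i, j) map_mx f (B_ i j).
Proof. by apply/matrixP => i j; rewrite !mxE. Qed.

Lemma bpolyE S n : lower_unitriangular S ->
  bpoly S n = ('X^n)%:M + map_mx polyC (last_row n S) *m monomials n.
Proof.
case=> Sd _; rewrite /bpoly big_ord_recr /= Sd map_mx1 scalemx1 addrC; congr (_ + _).
rewrite map_mxrow mul_mxrow_mxcol; apply: eq_bigr => l _.
by rewrite mul_mx_scalar.
Qed.

Lemma bpoly_col S n : lower_unitriangular S ->
  \mxcol_(k < n) bpoly S k = map_mx polyC (trunc n S) *m monomials n.
Proof.
case=> _ Su; rewrite /trunc mxblockEv.
have -> : map_mx polyC (\mxcol_(k < n) \mxrow_(l < n) S k l) =
    \mxcol_(k < n) \mxrow_(l < n) map_mx polyC (S k l).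
  by apply/matrixP => i j; rewrite !mxE.
rewrite mxcol_mul; apply: eq_mxcol => k; rewrite mul_mxrow_mxcol /bpoly.
rewrite (big_ord_widen n (fun l => 'X^l *: map_mx polyC (S k l))) // big_mkcond /=.
apply: eq_bigr => l _; rewrite mul_mx_scalar; case: ltnP => // lt_kl.
by rewrite Su // map_mx0 scaler0.
Qed.

Section Factored.
Variables (G S1 S2 : nat -> nat -> 'M[F]_p) (H : nat -> 'M[F]_p).
Hypothesis GE : gauss_borel G S1 H S2.
Hypothesis uG : forall n, trunc n G \in unitmx.

(** The coefficients of P1_n - x^n solve the linear system given by
    orthogonality to the monomials of degree less than n. *)
Lemma last_rowE n : last_row n S1 = - last_row n G *m invmx (trunc n G).
Proof.
case: (GE) => -[S1d _] _ _.
apply: (can_inj (mulmxK (uG n))); rewrite mulmxKV //.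
rewrite [LHS]mul_mxrow_mxblock -mxrowN; apply: eq_mxrow => l.
have := gauss_borel_row GE uG (ltnW (ltn_ord l)).
rewrite ltn_eqF // big_ord_recr /= S1d mul1mx => /eqP.
by rewrite addr_eq0 => /eqP.
Qed.

Lemma gauss_borel_bpoly n :
  bpoly S1 n = theta (block_mx (map_mx polyC (trunc n G)) (monomials n)
                               (map_mx polyC (last_row n G)) ('X^n)%:M).
Proof.
case: (GE) => uS1 _ _.
rewrite theta_block bpolyE // last_rowE mulNmx map_mxN mulNmx; congr (_ - _).
by rewrite map_mxM map_invmx.
Qed.

Lemma gauss_borel_H n :
  H n = theta (block_mx (trunc n G) (last_col n G) (last_row n G) (G n n)).
Proof.
case: (GE) => -[S1d _] _ _.
have := gauss_borel_row GE uG (leqnn n).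
rewrite eqxx big_ord_recr /= S1d mul1mx => <-.
by rewrite theta_block -!mulNmx -last_rowE mul_mxrow_mxcol addrC.
Qed.
End Factored.

Lemma gauss_borel_bpoly2 G S1 H S2 n :
  gauss_borel G S1 H S2 -> (forall n, trunc n G \in unitmx) ->
  (bpoly S2 n)^T = theta (block_mx (map_mx polyC (trunc n G))
                            (map_mx polyC (last_col n G))
                            (monomials n)^T ('X^n)%:M).
Proof.
move=> /gauss_borel_tr GE uG; rewrite (gauss_borel_bpoly GE).
  rewrite tr_theta tr_scalar_mx !map_trmx -tr_trunc trmxK.
  rewrite (_ : (last_row n _)^T = last_col n G) // /last_row tr_mxrow.
  by apply: eq_mxcol => k; rewrite trmxK.
by move=> m; rewrite -tr_trunc unitmx_tr.
Qed.

(** The Christoffel-Darboux kernel sees only the inverse of the truncated Gram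
    matrix: S2^T H^-1 S1 = G^-1 sandwiched between monomials in y and in x. *)
Lemma CD_E G S1 H S2 n :
  gauss_borel G S1 H S2 -> (forall n, trunc n G \in unitmx) ->
  CD S1 H S2 n = map_mx (map_poly polyC) (monomials n)^T
    *m map_mx polyC (map_mx polyC (invmx (trunc n G)) *m monomials n).
Proof.
move=> GE uG; case: (GE) => uS1 uS2 _.
pose D := trunc n (bdiag (fun k => invmx (H k))).
have mapPP r m (A : 'M[F]_(r, m)) :
    map_mx (map_poly polyC) (map_mx polyC A) = map_mx polyC (map_mx polyC A).
  by rewrite -!map_mx_comp; apply/matrixP => i j; rewrite !mxE /= map_polyC.
have -> : map_mx (map_poly polyC) (monomials n)^T
    *m map_mx polyC (map_mx polyC (invmx (trunc n G)) *m monomials n) =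
  (map_mx (map_poly polyC) (map_mx polyC (trunc n S2) *m monomials n))^T
    *m (map_mx polyC (map_mx polyC D)
    *m map_mx polyC (map_mx polyC (trunc n S1) *m monomials n)).
  rewrite (gauss_borel_invmx GE uG) !map_mxM trmx_mul mapPP.
  by rewrite !map_trmx !mulmxA.
rewrite -!bpoly_col // map_mxcol tr_mxcol map_mxcol.
rewrite /D map_mxblock map_mxblock mul_mxblock_mxrow mul_mxrow_mxcol.
apply: eq_bigr => k _; rewrite -mulmxA; congr (_ *m _).
rewrite (bigD1 k) //= /bdiag eqxx big1 ?addr0 => [|j].
  by rewrite -map_mx_comp.
by rewrite -val_eqE eq_sym => /negPf ->; rewrite !map_mx0 mul0mx.
Qed.
End Polynomials.

(** * Pairings and jets *)

Section Jets.
Variables (F : fieldType) (p q : nat) (x : 'I_q -> F) (kappa : 'I_q -> nat).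
Variable beta : forall a : 'I_q, 'I_(kappa a) -> 'M[{scalar {poly F}}]_p.

Definition taylor (a : 'I_q) (m : nat) (h : {poly F}) : F :=
  (m`!%:R)^-1 * (h^`(m)).[x a].

(** The spectral jet for any number of rows, so that the jets of all
    monomials up to a given degree form a single matrix. *)
Definition row_jet r (f : 'M[{poly F}]_(r, p)) : 'M[F]_(r, jdim p kappa) :=
  \mxrow_(a < q) \mxrow_(m < kappa a) map_mx (taylor a m) f.

Fact taylor_is_linear a m : scalar (taylor a m).
Proof.
move=> c f g; rewrite /taylor derivnD derivnZ hornerD hornerZ mulrDr.
by rewrite mulrCA.
Qed.
HB.instance Definition _ a m :=
  GRing.isLinear.Build F {poly F} F *%R (taylor a m) (taylor_is_linear a m).

Lemma scalar_polyC_mul (d : {scalar {poly F}}) c f : d (c%:P * f) = c * d f.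
Proof. by rewrite mul_polyC linearZ. Qed.

Lemma fpair_constM r s (A : 'M[F]_(r, s)) (P : 'M[{poly F}]_(s, p)) b :
  fpair (map_mx polyC A *m P) b = A *m fpair P b.
Proof.
apply/matrixP => i j; rewrite !mxE.
under eq_bigr do rewrite mxE raddf_sum.
rewrite exchange_big /=; apply: eq_bigr => k _; rewrite !mxE mulr_sumr.
by apply: eq_bigr => l _; rewrite scalar_polyC_mul.
Qed.

Lemma fpairD r (P Q : 'M[{poly F}]_(r, p)) b : fpair (P + Q) b = fpair P b + fpair Q b.
Proof.
apply/matrixP => i j; rewrite !mxE -big_split.
by apply: eq_bigr => k _; rewrite mxE raddfD.
Qed.

Lemma fpair_row_constM r s (A : 'M[F]_(r, s)) (P : 'M[{poly F}]_(s, p)) :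
  fpair_row (map_mx polyC A *m P) beta = A *m fpair_row P beta.
Proof.
rewrite /fpair_row mul_mxrow; apply: eq_mxrow => a; rewrite mul_mxrow.
by apply: eq_mxrow => m; rewrite fpair_constM.
Qed.

Lemma fpair_rowD r (P Q : 'M[{poly F}]_(r, p)) :
  fpair_row (P + Q) beta = fpair_row P beta + fpair_row Q beta.
Proof.
rewrite /fpair_row -mxrowD; apply: eq_mxrow => a; rewrite -mxrowD.
by apply: eq_mxrow => m; rewrite fpairD.
Qed.

Lemma row_jet_constM r s (A : 'M[F]_(r, s)) (P : 'M[{poly F}]_(s, p)) :
  row_jet (map_mx polyC A *m P) = A *m row_jet P.
Proof.
rewrite /row_jet mul_mxrow; apply: eq_mxrow => a; rewrite mul_mxrow.
apply: eq_mxrow => m; apply/matrixP => i j; rewrite !mxE raddf_sum.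
by apply: eq_bigr => k _; rewrite !mxE /= scalar_polyC_mul.
Qed.

Lemma row_jetD r (P Q : 'M[{poly F}]_(r, p)) : row_jet (P + Q) = row_jet P + row_jet Q.
Proof.
rewrite /row_jet -mxrowD; apply: eq_mxrow => a; rewrite -mxrowD.
by apply: eq_mxrow => m; rewrite map_mxD.
Qed.

Lemma map_polyM_CX (d : {scalar {poly F}}) (f g : {poly F}) :
  map_poly d (f%:P * g^:P) = d f *: g.
Proof.
apply/polyP => k; rewrite coef_map_id0 ?raddf0 // coefCM coefZ coef_map /=.
by rewrite mulrC scalar_polyC_mul mulrC.
Qed.

(** The finite-rank structure of the perturbation. The sign in the kernel and
    the one in the derivatives of the delta function cancel. *)
Lemma gram_vkernel k l :
  gram (vkernel x beta) k l =
    fpair_row ('X^k)%:M beta *m (row_jet ('X^l)%:M)^T.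
Proof.
rewrite /fpair_row /row_jet tr_mxrow mul_mxrow_mxcol.
apply/matrixP => i j; rewrite !mxE summxE.
transitivity (\sum_(a < q) \sum_(m < kappa a) (\sum_t \sum_s
  beta m s t (('X^k)%:M i s) * taylor a m ((('X^l)%:M : 'M_p) j t))).
  under eq_bigr => s _ do under eq_bigr => t _ do rewrite mxE.
  rewrite exchange_big /=.
  under eq_bigr => t _ do rewrite exchange_big /=.
  rewrite exchange_big /=; apply: eq_bigr => a _.
  under eq_bigr => t _ do rewrite exchange_big /=.
  rewrite exchange_big /=; apply: eq_bigr => m _.
  apply: eq_bigr => t _; apply: eq_bigr => s _.
  rewrite /tensor map_polyM_CX /ddelta derivnZ hornerZ /taylor.
  by rewrite mulrACA -expr2 sqrr_sign mul1r mulrCA.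
apply: eq_bigr => a _; rewrite tr_mxrow mul_mxrow_mxcol summxE.
apply: eq_bigr => m _; rewrite !mxE; apply: eq_bigr => t _.
by rewrite !mxE mulr_suml.
Qed.

(** On a kernel Q(y)^T W(x) with separated variables, the jet acts on Q alone;
    dually, the pairing with beta acts on W alone in kpair_row_sep. *)
Lemma jet01_sep s (Q : 'M[{poly F}]_(s, p)) (W : 'M[{poly F}]_(s, p)) :
  jet01 x kappa (map_mx (map_poly polyC) Q^T *m map_mx polyC W)
    = map_mx polyC (row_jet Q)^T *m W.
Proof.
rewrite /jet01 /row_jet tr_mxrow map_mxcol mxcol_mul; apply: eq_mxcol => a.
rewrite tr_mxrow map_mxcol mxcol_mul; apply: eq_mxcol => m.
apply/matrixP => i j; rewrite !mxE.
rewrite raddf_sum horner_sum scaler_sumr; apply: eq_bigr => k _.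
rewrite !mxE [_ * (W k j)%:P]mulrC !mul_polyC /= derivnZ hornerZ derivn_map horner_map /=.
by rewrite mulrC mul_polyC scalerA.
Qed.

Lemma kpair_row_sep r s (Q : 'M[{poly F}]_(r, s)) (W : 'M[{poly F}]_(s, p)) :
  kpair_row (map_mx (map_poly polyC) Q *m map_mx polyC W) beta
    = Q *m map_mx polyC (fpair_row W beta).
Proof.
rewrite /kpair_row /fpair_row map_mxrow mul_mxrow; apply: eq_mxrow => a.
rewrite map_mxrow mul_mxrow; apply: eq_mxrow => m.
apply/matrixP => i j; rewrite !mxE.
transitivity (\sum_k \sum_l beta m k j (W l k) *: Q i l).
  apply: eq_bigr => k _; rewrite mxE raddf_sum; apply: eq_bigr => l _.
  by rewrite !mxE [_ * (W l k)%:P]mulrC -map_polyM_CX.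
rewrite exchange_big /=; apply: eq_bigr => l _; rewrite !mxE raddf_sum mulr_sumr.
by apply: eq_bigr => k _; rewrite mulrC mul_polyC.
Qed.

End Jets.

(** * The perturbed biorthogonal families *)

Lemma quasidefinite_unitmx (F : fieldType) p (u : 'M[{poly {poly F}} -> F]_p) n :
  quasidefinite u -> trunc n (gram u) \in unitmx.
Proof.
case: n => [|n] qu; last by rewrite unitmxE unitfE qu.
rewrite (_ : trunc 0 _ = 1%:M) ?unitmx1 //.
by apply/mxblockP => -[].
Qed.

Section PerturbedGram.
Variables (F : fieldType) (p q : nat) (x : 'I_q -> F) (kappa : 'I_q -> nat).
Variable beta : forall a : 'I_q, 'I_(kappa a) -> 'M[{scalar {poly F}}]_p.
Variable u : 'M[{poly {poly F}} -> F]_p.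

Let uh := kadd u (vkernel x beta).
Let B n := fpair_row (monomials F p n) beta.
Let J n := (row_jet x kappa (monomials F p n))^T.

Lemma gram_kadd (v : 'M[{poly {poly F}} -> F]_p) k l :
  gram (kadd u v) k l = gram u k l + gram v k l.
Proof.
apply/matrixP => i j; rewrite !mxE -big_split; apply: eq_bigr => s _.
by rewrite -big_split; apply: eq_bigr => t _; rewrite mxE.
Qed.

Lemma fpair_row_monomials n :
  B n = \mxcol_(k < n) fpair_row ('X^k)%:M beta.
Proof.
apply/matrixP => i j; rewrite !mxE.
by apply: eq_bigr => k _; rewrite mxE.
Qed.

Lemma row_jet_monomials n :
  J n = \mxrow_(l < n) (row_jet x kappa ('X^l)%:M)^T.
Proof. by apply/matrixP => i j; rewrite !mxE. Qed.

Lemma trunc_gram_pert n :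
  trunc n (gram uh) = trunc n (gram u) + B n *m J n.
Proof.
rewrite fpair_row_monomials row_jet_monomials mul_mxcol_mxrow -mxblockD.
by apply: eq_mxblock => k l; rewrite gram_kadd gram_vkernel.
Qed.

Lemma last_row_gram_pert n :
  last_row n (gram uh) =
    last_row n (gram u) + fpair_row ('X^n)%:M beta *m J n.
Proof.
rewrite row_jet_monomials mul_mxrow -mxrowD.
by apply: eq_mxrow => l; rewrite gram_kadd gram_vkernel.
Qed.

Lemma last_col_gram_pert n :
  last_col n (gram uh) =
    last_col n (gram u) + B n *m (row_jet x kappa ('X^n)%:M)^T.
Proof.
rewrite fpair_row_monomials mxcol_mul -mxcolD.
by apply: eq_mxcol => k; rewrite gram_kadd gram_vkernel.
Qed.

Section Kernel.
Variables (S1 S2 : nat -> nat -> 'M[F]_p) (H : nat -> 'M[F]_p).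
Hypothesis GE : gauss_borel (gram u) S1 H S2.
Hypothesis uG : forall n, trunc n (gram u) \in unitmx.

(** The next five lemmas identify the blocks in the theorem with the blocks that
    remain after eliminating G. *)
Lemma jet01_CD n :
  jet01 x kappa (CD S1 H S2 n) =
    map_mx polyC (J n *m invmx (trunc n (gram u))) *m monomials F p n.
Proof. by rewrite (CD_E _ GE) // jet01_sep map_mxM mulmxA. Qed.

Lemma pert_mx_CD n :
  pert_mx x beta (CD S1 H S2 n) =
    1%:M + J n *m invmx (trunc n (gram u)) *m B n.
Proof. by rewrite /pert_mx jet01_CD fpair_row_constM. Qed.

Lemma kpair_row_CD n :
  kpair_row (CD S1 H S2 n) beta =
    (monomials F p n)^T *m map_mx polyC (invmx (trunc n (gram u)) *m B n).
Proof. by rewrite (CD_E _ GE) // kpair_row_sep fpair_row_constM. Qed.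

Lemma fpair_row_bpoly n :
  fpair_row (bpoly S1 n) beta = fpair_row ('X^n)%:M beta
    - last_row n (gram u) *m invmx (trunc n (gram u)) *m B n.
Proof.
case: (GE) => uS1 _ _.
rewrite bpolyE // fpair_rowD fpair_row_constM (last_rowE GE uG).
by rewrite !mulNmx.
Qed.

Lemma tr_jet_bpoly n :
  (jet x kappa (bpoly S2 n))^T = (row_jet x kappa ('X^n)%:M)^T
    - J n *m invmx (trunc n (gram u)) *m last_col n (gram u).
Proof.
case: (GE) => _ uS2 _.
rewrite (_ : jet x kappa _ = row_jet x kappa (bpoly S2 n)) //.
rewrite bpolyE // row_jetD row_jet_constM linearD /= trmx_mul; congr (_ + _).
have uGt m : trunc m (fun k l => (gram u l k)^T) \in unitmx.
  by rewrite -tr_trunc unitmx_tr.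
rewrite (last_rowE (gauss_borel_tr GE) uGt) mulNmx linearN /= mulmxN.
rewrite -tr_trunc -trmx_inv trmx_mul trmxK mulmxA; congr (- (_ *m _)).
by rewrite /last_row tr_mxrow; apply: eq_mxcol => k; rewrite trmxK.
Qed.

Variables (S1h S2h : nat -> nat -> 'M[F]_p) (Hh : nat -> 'M[F]_p).
Hypothesis GhE : gauss_borel (gram uh) S1h Hh S2h.
Hypothesis uGh : forall n, trunc n (gram uh) \in unitmx.

Let unitGBJ n : trunc n (gram u) + B n *m J n \in unitmx.
Proof. by rewrite -trunc_gram_pert; apply: uGh. Qed.

Let unitGC n : map_mx polyC (trunc n (gram u)) \in unitmx.
Proof. by rewrite map_unitmx. Qed.

Let unitGBJC n : map_mx polyC (trunc n (gram u))
    + map_mx polyC (B n) *m map_mx polyC (J n) \in unitmx.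
Proof. by rewrite -map_mxM -map_mxD map_unitmx; apply: unitGBJ. Qed.

Lemma pert_mx_CD_unitmx n : pert_mx x beta (CD S1 H S2 n) \in unitmx.
Proof. by rewrite pert_mx_CD; apply: pert_unitmx (uG n) (unitGBJ n). Qed.

(** Specializes theta_pert to the last column, last row and corner of the Gram
    matrix. *)
Lemma pert_H n :
  Hh n = theta (block_mx (pert_mx x beta (CD S1 H S2 n))
                         (- (jet x kappa (bpoly S2 n))^T)
                         (fpair_row (bpoly S1 n) beta) (H n)).
Proof.
rewrite (gauss_borel_H GhE uGh) trunc_gram_pert last_col_gram_pert last_row_gram_pert.
rewrite gram_kadd gram_vkernel (theta_pert (uG n) (unitGBJ n)).
rewrite pert_mx_CD fpair_row_bpoly tr_jet_bpoly opprB.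
by rewrite -(gauss_borel_H GE uG).
Qed.

Lemma map_pert_mx_CD n :
  map_mx polyC (pert_mx x beta (CD S1 H S2 n)) =
    1%:M + map_mx polyC (J n) *m invmx (map_mx polyC (trunc n (gram u)))
             *m map_mx polyC (B n).
Proof. by rewrite pert_mx_CD map_mxD map_mx1 !map_mxM map_invmx. Qed.

(** Specializes theta_pert to the border chi, whose column is not perturbed:
    hence j = 0. *)
Lemma pert_bpoly1 n :
  bpoly S1h n = theta (block_mx (map_mx polyC (pert_mx x beta (CD S1 H S2 n)))
                                (jet01 x kappa (CD S1 H S2 n))
                                (map_mx polyC (fpair_row (bpoly S1 n) beta))
                                (bpoly S1 n)).
Proof.
have := theta_pert (unitGC n) (unitGBJC n) (monomials F p n) 0
  (map_mx polyC (last_row n (gram u))) (map_mx polyC (fpair_row ('X^n)%:M beta))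
  ('X^n)%:M.
rewrite !mulmx0 !addr0 subr0 -!map_mxM -!map_mxD.
rewrite -trunc_gram_pert -last_row_gram_pert -(gauss_borel_bpoly GhE) // => ->.
rewrite map_pert_mx_CD jet01_CD fpair_row_bpoly map_mxB !map_mxM !map_invmx.
by rewrite (gauss_borel_bpoly GE uG).
Qed.

(** Specializes theta_pert to the border chi^T, whose row is not perturbed:
    hence b = 0. The two off-diagonal blocks then carry a sign each, and these
    cancel (thetaNN). *)
Lemma pert_bpoly2 n :
  (bpoly S2h n)^T =
    theta (block_mx (map_mx polyC (pert_mx x beta (CD S1 H S2 n)))
                    (map_mx polyC (jet x kappa (bpoly S2 n))^T)
                    (kpair_row (CD S1 H S2 n) beta)
                    (bpoly S2 n)^T).
Proof.
have := theta_pert (unitGC n) (unitGBJC n) (map_mx polyC (last_col n (gram u)))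
  (map_mx polyC (row_jet x kappa ('X^n)%:M)^T) (monomials F p n)^T 0 ('X^n)%:M.
rewrite !mul0mx !addr0 -!map_mxM -!map_mxD.
rewrite -trunc_gram_pert -last_col_gram_pert -(gauss_borel_bpoly2 _ GhE) // => ->.
rewrite -(gauss_borel_bpoly2 _ GE uG) map_pert_mx_CD kpair_row_CD tr_jet_bpoly.
rewrite -thetaNN sub0r opprK opprB.
by rewrite [in RHS]map_mxB !map_mxM !map_invmx mulmxA.
Qed.

End Kernel.
End PerturbedGram.

Theorem theorem10 (R : realType) (p : nat) (hp : (1 <= p)%N)
  (u : 'M[{poly {poly R[i]}} -> R[i]]_p) (hu : linear_kernel u)
  (q : nat) (x : 'I_q -> R[i]) (hx : injective x) (kappa : 'I_q -> nat)
  (beta : forall a : 'I_q, 'I_(kappa a) -> 'M[{scalar {poly R[i]}}]_p)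
  (hbeta : bimod_independent beta)
  (uh : 'M[{poly {poly R[i]}} -> R[i]]_p) (huh : uh = kadd u (vkernel x beta))
  (qu : quasidefinite u) (quh : quasidefinite uh)
  (S1 S2 S1h S2h : nat -> nat -> 'M[R[i]]_p) (H Hh : nat -> 'M[R[i]]_p)
  (hG : gauss_borel (gram u) S1 H S2)
  (hGh : gauss_borel (gram uh) S1h Hh S2h)
  (hperp : perpR u (KerR beta) = [set 0] \/ perpL u (ideal x kappa) = [set 0]) :
  forall n : nat,
  [/\ pert_mx x beta (CD S1 H S2 n) \in unitmx,
      bpoly S1h n =
        theta (block_mx
          (map_mx polyC (pert_mx x beta (CD S1 H S2 n)))
          (jet01 x kappa (CD S1 H S2 n))
          (map_mx polyC (fpair_row (bpoly S1 n) beta))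
          (bpoly S1 n)),
      (bpoly S2h n)^T =
        theta (block_mx
          (map_mx polyC (pert_mx x beta (CD S1 H S2 n)))
          (map_mx polyC (jet x kappa (bpoly S2 n))^T)
          (kpair_row (CD S1 H S2 n) beta)
          (bpoly S2 n)^T) &
      Hh n =
        theta (block_mx
          (pert_mx x beta (CD S1 H S2 n))
          (- (jet x kappa (bpoly S2 n))^T)
          (fpair_row (bpoly S1 n) beta)
          (H n))].
Proof.
have uG n := quasidefinite_unitmx n qu.
have uGh n := quasidefinite_unitmx n quh.
move=> n; rewrite huh in hGh uGh; split.
- exact (pert_mx_CD_unitmx hG uG uGh n).
- exact (pert_bpoly1 hG uG hGh uGh n).
- exact (pert_bpoly2 hG uG hGh uGh n).
- exact (pert_H hG uG hGh uGh n).
Qed.
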